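(* Let $q$ be a prime power and $L(X)=a_1X^q+a_0X\in\mathbb{F}_{q^2}[X]$. Then $f(X)=\mathrm{Tr}_{q^2/q}(L(X)/X)$ has no root in $\mathbb{F}_{q^2}^*$ if and only if the polynomial $g(X)=X^2+\mathrm{Tr}_{q^2/q}(a_0)X+a_1^{q+1}\in\mathbb{F}_q[X]$ has two distinct roots in $\mathbb{F}_q$.
   Context: $\mathrm{Tr}_{q^2/q}$ denotes the trace map from $\mathbb{F}_{q^2}$ to $\mathbb{F}_q$. *)

(* Defs.v *)
From HB Require Import structures.
From mathcomp Require Import all_boot all_order all_fingroup all_algebra.
From mathcomp Require Import all_solvable all_field.
Set Implicit Arguments.
Unset Strict Implicit.
Unset Printing Implicit Defensive.
Import GRing.Theory.
Local Open Scope ring_scope.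

Definition prime_power (q : nat) : Prop :=
  exists p k : nat, [/\ prime p, (0 < k)%N & q = (p ^ k)%N].

(* F is F_q and K is F_{q^2}; F is identified with the subfield 1 = F%:A of K,
   so the trace to F takes its values in K. Every finite extension of a finite
   field carries a splittingFieldType structure (FinSplittingFieldType). *)
Section TraceQuadratic.
Variables (F : finFieldType) (K : splittingFieldType F).

Definition Tr (x : K) : K := galTrace 1%VS fullv x.

Definition Lpoly (q : nat) (a1 a0 : K) : {poly K} := a1 *: 'X^q + a0 *: 'X.

(* Only meaningful for x != 0, since 0 / 0 = 0 here. *)
Definition f (q : nat) (a1 a0 x : K) : K := Tr ((Lpoly q a1 a0).[x] / x).

Definition g (q : nat) (a1 a0 : K) : {poly K} :=
  'X^2 + Tr a0 *: 'X + (a1 ^+ q.+1)%:P.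

End TraceQuadratic.

(* Main.v *)
(** Put [T = Tr a0] and [N = a1 ^ (q + 1)]. For [x != 0] one has
    [f x = z + z ^ q + T] with [z = a1 * x ^ (q - 1)], and by Hilbert 90 the
    elements [z] of this form are exactly those of norm [N]. So [f] has a
    nonzero root iff some [z] in [K] has trace [- T] and norm [N], that is, iff
    [g] is the product of ['X - z] and its conjugate ['X - z ^ q]. This happens
    when [g] is irreducible over [F] (its roots then lie in [K] and are
    conjugate) and when [g] has a double root in [F]; it cannot happen when [g]
    has distinct roots in [F], as such roots are their own conjugates. *)

Require Import Defs.
From mathcomp Require Import all_boot all_order all_fingroup all_algebra.
From mathcomp Require Import all_solvable all_field.
From mathcomp Require Import ring.
Import GRing.Theory.
Local Open Scope ring_scope.

Lemma quadratic_irreducible (F : fieldType) (p : {poly F}) :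
  size p = 3 -> (forall x, ~~ root p x) -> irreducible_poly p.
Proof.
move=> sz_p no_root; split=> [|d d_neq1 d_dvd]; first by rewrite sz_p.
have p_neq0 : p != 0 by rewrite -size_poly_eq0 sz_p.
have := dvdp_leq p_neq0 d_dvd; rewrite sz_p => d_le3.
have d_neq0 : d != 0 by apply: contraNneq p_neq0 => d0; rewrite -dvd0p -d0.
have [d_eq2|d_neq2] := eqVneq (size d) 2.
  have [x dx0] := poly2_root d_eq2.
  by case/negP: (no_root x); rewrite -dvdp_XsubCl (dvdp_trans _ d_dvd) ?dvdp_XsubCl.
rewrite -dvdp_size_eqp // sz_p; move: d_neq0 d_neq1 d_neq2 d_le3.
by rewrite -size_poly_eq0; case: (size d) => [|[|[|[|n]]]].
Qed.

Lemma expf_order (F : finFieldType) (L : fieldExtType F) (x : L) :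
  x ^+ (#|F| ^ \dim {:L}) = x.
Proof. by apply/eqP; rewrite -(Fermat's_little_theorem {:L}%AS) memvf. Qed.

(** Adjoining a root of [p] gives a field with [#|F| ^ (size p).-1] elements, all of them roots of
    the right-hand polynomial. The two polynomials thus share a root, so the irreducible one divides
    the other. *)
Lemma irreducible_dvd_Xorder (F : finFieldType) (p : {poly F}) :
  irreducible_poly p -> p %| 'X^(#|F| ^ (size p).-1) - 'X.
Proof.
move=> irr_p; have [L dimL [z pz0 _]] := irredp_FAdjoin irr_p.
set h := 'X^_ - 'X; have [//|p_ndvd] := boolP (p %| h).
have /coprimep_root /(_ pz0) : coprimep (map_poly (in_alg L) p) (map_poly (in_alg L) h).
  by rewrite coprimep_map irreducible_poly_coprime.
by rewrite rmorphB /= map_polyXn map_polyX !hornerE -dimL expf_order subrr eqxx.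
Qed.

(** The dividend is the product of ['X - x] over all [x] in [L], so [p] is associate to a nonempty
    subproduct. *)
Lemma Xorder_dvd_root (F : finFieldType) (L : fieldExtType F) (p : {poly L}) :
  p %| 'X^(#|F| ^ \dim {:L}) - 'X -> size p != 1 -> exists x, root p x.
Proof.
pose ffL := finvect_type L.
have -> : 'X^(#|F| ^ \dim {:L}) - 'X = \prod_(x <- enum ffL) ('X - x%:P) :> {poly L}.
  rewrite big_enum -(finField_genPoly ffL) -(card_vspacef (Vector.class ffL)).
  by rewrite card_vspace.
case/dvdp_prod_XsubC=> m p_eq; rewrite (eqp_size p_eq) size_prod_XsubC eqSS.
case: (mask m _) p_eq => // x s p_eq _; exists x.
by rewrite (eqp_root p_eq) root_prod_XsubC mem_head.
Qed.

Section QuadraticExtension.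

Variables (F : finFieldType) (K : splittingFieldType F).
Hypothesis dimK : (\dim {:K} = 2)%N.

Let q := #|F|.

Lemma expqq (x : K) : (x ^+ q) ^+ q = x.
Proof. by rewrite -exprM -[RHS]expf_order dimK. Qed.

Lemma expq_in_alg (r : F) : (r%:A : K) ^+ q = r%:A.
Proof. by rewrite -(rmorphXn (in_alg K)) expf_card. Qed.

Lemma expq_fixed (x : K) : x ^+ q = x -> exists r : F, x = r%:A.
Proof.
move=> xq; have : x \in (1%AS : {subfield K}).
  by rewrite Fermat's_little_theorem dimv1 expn1 -/q xq.
by case/vlineP=> r ->; exists r.
Qed.

Lemma gal_Frobenius : {alpha : gal_of {:K} |
  generator 'Gal({:K} / 1%VS)%g alpha & forall x, alpha x = x ^+ q}.
Proof.
have [alpha gen_alpha Dalpha] := finField_galois_generator (sub1v {:K}%AS).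
by exists alpha => // x; rewrite Dalpha ?memvf // dimv1 expn1.
Qed.

Lemma expqD (x y : K) : (x + y) ^+ q = x ^+ q + y ^+ q.
Proof. by have [alpha _ Dalpha] := gal_Frobenius; rewrite -!Dalpha rmorphD. Qed.

(** The Galois group has order 2, hence consists of the identity and Frobenius. A general [op]
    covers both trace and norm. *)
Lemma big_gal (R : Type) (idx : R) (op : Monoid.com_law idx) (h : K -> R) x :
  \big[op/idx]_(s in 'Gal({:K} / 1%VS)%g) h (s x) = op (h x) (h (x ^+ q)).
Proof.
have [alpha /eqP genG Dalpha] := gal_Frobenius.
have cardG : #|'Gal({:K} / 1%VS)%g| = 2%N.
  by rewrite -galois_dim ?finField_galois ?sub1v // dimK dimv1 divn1.
have o_alpha : #[alpha]%g = 2%N by rewrite /order -genG cardG.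
have alpha_neq1 : alpha != 1%g by rewrite -order_eq1 o_alpha.
have -> : 'Gal({:K} / 1%VS)%g = [set 1%g; alpha].
  apply/esym/eqP; rewrite eqEcard cards2 eq_sym alpha_neq1 cardG andbT.
  by rewrite genG; apply/subsetP=> s /set2P[]->; rewrite ?group1 ?cycle_id.
rewrite big_setU1 ?inE 1?eq_sym //= big_set1.
by rewrite gal_id Dalpha.
Qed.

Lemma TrE (x : K) : Tr x = x + x ^+ q.
Proof. exact: (big_gal _ _ _ id). Qed.

Lemma Tr_in_F (x : K) : exists t : F, Tr x = t%:A.
Proof. by apply: expq_fixed; rewrite TrE expqD expqq addrC. Qed.

Lemma norm_in_F (x : K) : exists n : F, x ^+ q.+1 = n%:A.
Proof. by apply: expq_fixed; rewrite exprS exprMn expqq mulrC. Qed.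

(** Hilbert 90 gives [y = b / b ^+ q]; take the inverse of [b]. *)
Lemma norm1_expq (y : K) :
  y ^+ q.+1 = 1 -> exists2 x : K, x != 0 & x ^+ q = y * x.
Proof.
move=> Ny; have [alpha gen_alpha Dalpha] := gal_Frobenius.
have /(Hilbert's_theorem_90 gen_alpha (memvf y)) [b [_ b_neq0]] :
  galNorm 1 {:K} y == 1 by rewrite /galNorm (big_gal _ _ _ id) /= -exprS Ny.
rewrite Dalpha => yE; exists b^-1; first by rewrite invr_eq0.
by rewrite yE exprVn mulrAC divff // mul1r.
Qed.

Lemma f_root_conjugate (a1 a0 : K) :
  (exists x : K, x != 0 /\ f q a1 a0 x = 0) <->
  (exists z : K, z + z ^+ q = - Tr a0 /\ z ^+ q.+1 = a1 ^+ q.+1).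
Proof.
have fE (x : K) : x != 0 -> f q a1 a0 x =
    a1 * (x ^+ q / x) + (a1 * (x ^+ q / x)) ^+ q + Tr a0.
  move=> x_neq0; rewrite /f /Lpoly hornerD !hornerZ hornerXn hornerX mulrDl mulfK // -mulrA.
  by rewrite !TrE expqD; ring.
split=> [[x [x_neq0 fx0]]|[z [Tz Nz]]].
  exists (a1 * (x ^+ q / x)); split.
    by apply/eqP; rewrite -addr_eq0 -fE ?fx0.
  rewrite exprMn [(x ^+ q / x) ^+ _]exprS exprMn expqq exprVn.
  by rewrite [x ^+ q / x * _]mulrA divfK // divff ?expf_neq0 // mulr1.
(* If [a1 = 0], one cannot divide by it; but then [z = 0], so [Tr a0 = 0] and [f] vanishes at every
   nonzero point, for instance 1. *)
have [a1_0|a1_neq0] := eqVneq a1 0.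
  have /eqP : z ^+ q.+1 = 0 by rewrite Nz a1_0 expr0n.
  rewrite expf_eq0 /= => /eqP z0.
  exists 1; split; first exact: oner_neq0.
  by rewrite fE ?oner_neq0 // a1_0 mul0r -z0 Tz addNr.
(* Since [z] and [a1] have equal norms, [z / a1] has norm 1. *)
have [|x x_neq0 xq] := @norm1_expq (z / a1).
  by rewrite exprMn exprVn Nz divff // expf_neq0.
exists x; split=> //; rewrite fE // xq mulfK // mulrC divfK //.
by rewrite Tz addNr.
Qed.

End QuadraticExtension.

Theorem theorem3p2 (q : nat) (hq : prime_power q)
    (F : finFieldType) (hF : #|F| = q)
    (K : splittingFieldType F) (hK : (\dim (fullv : {vspace K}) = 2)%N)
    (a1 a0 : K) :
  g q a1 a0 \is a polyOver 1%VS /\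
  ((~ exists x : K, x != 0 /\ f q a1 a0 x = 0) <->
   (exists r1 r2 : F, [/\ r1 != r2, root (g q a1 a0) r1%:A
                        & root (g q a1 a0) r2%:A])).
Proof.
rewrite -{q hq}hF; set q := #|F|.
have [t tE] := Tr_in_F _ _ hK a0; have [n nE] := norm_in_F _ _ hK a1.
(* [g0] is [g] with its coefficients viewed in [F], where irreducibility makes sense. *)
pose g0 : {poly F} := 'X^2 + (t *: 'X + n%:P).
have gE : g q a1 a0 = map_poly (in_alg K) g0.
  rewrite /g nE tE !rmorphD /= map_polyXn map_polyZ /= map_polyX map_polyC /=.
  by rewrite addrA.
have sz_g0 : size g0 = 3.
  rewrite /g0 size_polyDl size_polyXn // ltnS.
  apply: leq_trans (size_polyD _ _) _; rewrite geq_max.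
  rewrite (leq_trans (size_scale_leq _ _)) ?size_polyX //.
  by rewrite (leq_trans (size_polyC_leq1 _)).
have g0r (r : F) : root (g q a1 a0) r%:A = root g0 r.
  by rewrite gE (fmorph_root (in_alg K)).
have gz (z : K) : root (g q a1 a0) z = (z ^+ 2 + t%:A * z + n%:A == 0).
  by rewrite rootE /g !hornerE tE nE.
have g0E (r : F) : root g0 r = (r ^+ 2 + t * r + n == 0).
  by rewrite rootE !(hornerD, hornerZ, hornerXn, hornerX, hornerC) addrA.
split; first by rewrite gE; apply/polyOver1P; exists g0.
rewrite f_root_conjugate // -/q tE nE; split=> [no_z|[r1 [r2 [r1r2 gr1 gr2]]] [z [Tz Nz]]].
  have [/existsP [r gr0]|/existsPn no_root] := boolP [exists r, root g0 r].
    have /eqP gr : r ^+ 2 + t * r + n == 0 by rewrite -g0E.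
    (* The second root comes from Vieta. If it equals [r], then [r] itself has trace [2r = -t] and
       norm [r ^+ 2 = n], which [no_z] forbids. *)
    exists r, (- t - r); rewrite !g0r; split=> //; last first.
      by rewrite g0E; apply/eqP; rewrite -[RHS]gr; ring.
    apply/eqP => r_eq; case: no_z; exists r%:A.
    rewrite exprS expq_in_alg -scalerDl -scaleNr mulr_algl scalerA; split; congr (_%:A).
      by rewrite {2}r_eq; ring.
    by rewrite {2}r_eq -[LHS]addr0 -gr; ring.
  have irr_g0 : irreducible_poly g0.
    exact: quadratic_irreducible.
  (* An irreducible quadratic over [F] divides ['X^(q ^ 2) - 'X], so it has a root in [K]. *)
  have [||z gz0] := @Xorder_dvd_root F K (g q a1 a0).
  - have := irreducible_dvd_Xorder _ _ irr_g0; rewrite sz_g0 hK gE.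
    rewrite -(dvdp_map (in_alg K)) rmorphB /= map_polyXn map_polyX.
    by [].
  - by rewrite gE size_map_poly sz_g0.
  case: no_z; exists z; move: (gz0); rewrite gz => /eqP eqz.
  (* Frobenius fixes the coefficients, so the conjugate of [z] is a root too. *)
  have eqzq : (z ^+ q) ^+ 2 + t%:A * z ^+ q + n%:A = 0.
    have := congr1 (fun u => u ^+ q) eqz; rewrite /= !expqD // exprAC exprMn !expq_in_alg.
    by rewrite expr0n gtn_eqF // ltnW ?finNzRing_gt1.
  have zq_neq : z - z ^+ q != 0.
    rewrite subr_eq0 eq_sym; apply/eqP => /(expq_fixed _ _ _) [r zr].
    by case/negP: (no_root r); rewrite -g0r -zr.
  (* The difference of the two root equations is [(z - z ^+ q) * (z + z ^+ q + t%:A) = 0]. *)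
  have Tz : z + z ^+ q = - t%:A.
    apply/eqP; rewrite -addr_eq0 -(mulrI_eq0 _ (mulfI zq_neq)); apply/eqP.
    by rewrite -[RHS](subrr 0) -{1}eqz -eqzq; ring.
  split=> //; rewrite exprS.
  have tE' : t%:A = - (z + z ^+ q) by rewrite Tz opprK.
  by rewrite -[LHS]addr0 -eqz tE'; ring.
(* Here [g] factors as [('X - z) * ('X - z ^+ q)]. If [r = z ^+ q], another Frobenius gives [r = z],
   so two roots in [F] must coincide. *)
have root_z (r : F) : root (g q a1 a0) r%:A -> r%:A = z.
  have tE' : t%:A = - (z + z ^+ q) by rewrite Tz opprK.
  rewrite gz tE' -Nz [z ^+ q.+1]exprS => r_root.
  have : (r%:A - z) * (r%:A - z ^+ q) == 0.
    by rewrite -(eqP r_root); apply/eqP; ring.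
  rewrite mulf_eq0 !subr_eq0 => /orP[/eqP //|/eqP rE].
  by rewrite -[RHS](expqq _ _ hK) -rE expq_in_alg.
by case/eqP: r1r2; apply: (fmorph_inj (in_alg K)); rewrite /= (root_z r1 gr1) (root_z r2 gr2).
Qed.
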